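(* Let $t_0>0$, let $\alpha,\beta,\gamma$ be quotients of odd positive integers, let $r_1,r_2\in C([t_0,\infty),(0,\infty))$ satisfy $\int_{t_0}^{\infty}r_1^{-1/\alpha}(s)\,ds<\infty$ and $\int_{t_0}^{\infty}r_2^{-1/\beta}(s)\,ds<\infty$, let $q\in C([t_0,\infty),[0,\infty))$ not vanish eventually, and let $\sigma\in C^1([t_0,\infty),(0,\infty))$ satisfy $\sigma(t)\ge t$ and $\sigma'(t)\ge 0$ for all $t\ge t_0$. Consider the equation $$\left(r_2(t)\left(\left(r_1(t)(y'(t))^{\alpha}\right)'\right)^{\beta}\right)'+q(t)\,y^{\gamma}(\sigma(t))=0,\quad t\ge t_0.\qquad (E)$$ If $$\int_{t_0}^{\infty}r_1^{-\frac1\alpha}(v)\left(\int_{t_0}^{v}r_2^{-\frac1\beta}(u)\left(\int_{t_0}^{u}q(s)\,ds\right)^{\frac1\beta}du\right)^{\frac1\alpha}dv=\infty,$$ then $(E)$ has property A.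
   Context: Powers whose exponents are quotients of odd positive integers are taken as real-valued odd functions, also for negative arguments. ''$q$ does not vanish eventually'' means that $q$ is not identically zero on any half-line $[T,\infty)$. A solution of $(E)$ is a nontrivial real-valued function $y\in C([T_y,\infty),\mathbb{R})$, $T_y\ge t_0$, such that $y$, $r_1(y')^{\alpha}$ and $r_2((r_1(y')^{\alpha})')^{\beta}$ are continuous and differentiable on $[T_y,\infty)$ and $y$ satisfies $(E)$ on $[T_y,\infty)$. Only solutions with $\sup\{|y(t)|:T\le t<\infty\}>0$ for every $T\ge T_y$ are considered, and it is assumed that $(E)$ possesses such solutions. A solution is oscillatory if it has arbitrarily large zeros in $[T_y,\infty)$, and nonoscillatory otherwise. Equation $(E)$ has property A if every solution $y$ is either oscillatory or satisfies $\lim_{t\to\infty}y(t)=0$. *)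

(* Defs.v *)
From Stdlib Require Import Reals.
From Coquelicot Require Import Coquelicot.
Open Scope R_scope.

Definition odd_quotient (a : R) : Prop :=
  exists m n : nat, a = INR (2 * m + 1) / INR (2 * n + 1).

(* The odd real power: for a = (2m+1)/(2n+1) it is the real (2n+1)-th root of
   x^(2m+1), also for x < 0.  The factor [sign x] makes the value at 0 equal
   to 0, whereas [Rpower 0 a = 1].  For x > 0 and any real a it is
   [Rpower x a]. *)
Definition opow (x a : R) : R := sign x * Rpower (Rabs x) a.

Definition half_line (T : R) : R -> Prop := fun t => T <= t.

(* [f' = g] on [T, oo): one-sided derivative at T, so that values to the left
   of T are irrelevant. *)
Definition derivative_on (T : R) (f g : R -> R) : Prop :=
  forall t, T <= t -> D_in f g (half_line T) t.

Definition integral_finite (f : R -> R) (t0 : R) : Prop :=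
  ex_RInt_gen f (at_point t0) (Rbar_locally p_infty).

Definition integral_infinite (f : R -> R) (t0 : R) : Prop :=
  is_lim (fun T => RInt f t0 T) p_infty p_infty.

Definition vanishes_eventually (t0 : R) (q : R -> R) : Prop :=
  exists T, t0 <= T /\ forall t, T <= t -> q t = 0.

(* [y1], [z] and [w] are y', (r1 (y')^alpha)' and
   (r2 ((r1 (y')^alpha)')^beta)'; they are determined on [Ty, oo). *)
Definition is_solution (t0 alpha beta gamma : R) (r1 r2 q sigma : R -> R)
    (Ty : R) (y : R -> R) : Prop :=
  t0 <= Ty /\
  (exists t, Ty <= t /\ y t <> 0) /\
  exists y1 z w : R -> R,
    let L1 := fun t => r1 t * opow (y1 t) alpha in
    let L2 := fun t => r2 t * opow (z t) beta in
    continuous_on (half_line Ty) y /\ derivative_on Ty y y1 /\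
    continuous_on (half_line Ty) L1 /\ derivative_on Ty L1 z /\
    continuous_on (half_line Ty) L2 /\ derivative_on Ty L2 w /\
    forall t, Ty <= t -> w t + q t * opow (y (sigma t)) gamma = 0.

(* The supremum may be infinite, hence [Lub_Rbar]. *)
Definition is_proper_solution (t0 alpha beta gamma : R) (r1 r2 q sigma : R -> R)
    (Ty : R) (y : R -> R) : Prop :=
  is_solution t0 alpha beta gamma r1 r2 q sigma Ty y /\
  forall T, Ty <= T ->
    Rbar_lt (Finite 0) (Lub_Rbar (fun x => exists t, T <= t /\ x = Rabs (y t))).

Definition oscillatory (Ty : R) (y : R -> R) : Prop :=
  forall T, Ty <= T -> exists t, T <= t /\ y t = 0.

Definition property_A (t0 alpha beta gamma : R) (r1 r2 q sigma : R -> R) : Prop :=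
  forall (Ty : R) (y : R -> R),
    is_proper_solution t0 alpha beta gamma r1 r2 q sigma Ty y ->
    oscillatory Ty y \/ is_lim y p_infty (Finite 0).

(* Main.v *)
Require Import Defs.
From Stdlib Require Import Reals Lra Classical Ranalysis5.
From Coquelicot Require Import Coquelicot.
Open Scope R_scope.

(** Write [L1 = r1 (y')^alpha] and [L2 = r2 (L1')^beta], and let [Q], [P], [I] be
    the three nested integrals of the divergence hypothesis, so that
    [Q' = q], [P' = r2^(-1/beta) Q^(1/beta)], [I' = r1^(-1/alpha) P^(1/alpha)].

    All three tend to infinity. For [I] this is the hypothesis. Since
    [r1^(-1/alpha)] is integrable, [I] could not diverge if [P] were bounded,
    and since [r2^(-1/beta)] is integrable, [P] could not diverge if [Q] were
    bounded ([weight_tends_to_infinity]); both are nondecreasing.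

    Let [y] be a nonoscillatory solution. As all powers are odd, [- y] is a
    solution too, so [y] may be taken eventually positive. Then [L2' <= 0]
    because [sigma t >= t] keeps [y (sigma t)] positive. A monotone function
    has a constant sign near infinity ([eventually_signed_primitive]), hence so
    have [L2], [L1], and [y'], and [y] itself is eventually monotone. Either
    [y] tends to [0], or [y >= c > 0] near infinity
    ([monotone_positive_limit_or_bound]).

    In the second case the equation gives [L2' <= - c^gamma Q'].
    Because [Q] tends to infinity the integration constant is negligible and
    [L2 <= - k Q] for some [k > 0] ([integrate_rate]). Solving for [L1'] gives
    [L1' <= - k^(1/beta) P'] ([quasi_derivative_bound]), and the same two moves
    lead to [L1 <= - k' P] and to [y <= - k'' I]. So [y] tends to minus
    infinity, which contradicts its positivity
    ([eventually_positive_solution_tends_to_0]). *)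

(** * Odd powers *)

Lemma odd_quotient_pos (a : R) : odd_quotient a -> 0 < a.
Proof.
  intros [m [n ->]].
  apply Rdiv_lt_0_compat; apply lt_0_INR; rewrite Nat.add_1_r; apply Nat.lt_0_succ.
Qed.

Lemma opow_pos_eq (x a : R) : 0 < x -> opow x a = Rpower x a.
Proof.
  intros Hx. unfold opow. rewrite sign_eq_1 by exact Hx.
  rewrite Rabs_pos_eq by lra. ring.
Qed.

Lemma opow_0 (a : R) : opow 0 a = 0.
Proof. unfold opow. rewrite sign_0. ring. Qed.

Lemma opow_opp (x a : R) : opow (- x) a = - opow x a.
Proof. unfold opow. rewrite sign_opp, Rabs_Ropp. ring. Qed.

Lemma quasi_derivative_opp (r x a : R) : - (r * opow x a) = r * opow (- x) a.
Proof. rewrite opow_opp. ring. Qed.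

Lemma Rpower_pos (x a : R) : 0 < Rpower x a.
Proof. apply exp_pos. Qed.

Lemma opow_pos (x a : R) : 0 < x -> 0 < opow x a.
Proof. intros Hx. rewrite opow_pos_eq by exact Hx. apply Rpower_pos. Qed.

Lemma opow_neg (x a : R) : x < 0 -> opow x a < 0.
Proof.
  intros Hx. assert (H : 0 < opow (- x) a) by (apply opow_pos; lra).
  rewrite opow_opp in H. lra.
Qed.

Lemma opow_nonneg (x a : R) : 0 <= x -> 0 <= opow x a.
Proof.
  intros [Hx | <-]; [left; now apply opow_pos | rewrite opow_0; lra].
Qed.

Lemma opow_nonneg_inv (x a : R) : 0 <= opow x a -> 0 <= x.
Proof.
  intros H. destruct (Rle_or_lt 0 x) as [Hx | Hx]; [exact Hx |].
  apply (opow_neg x a) in Hx. lra.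
Qed.

Lemma opow_nonpos_inv (x a : R) : opow x a <= 0 -> x <= 0.
Proof.
  intros H. destruct (Rle_or_lt x 0) as [Hx | Hx]; [exact Hx |].
  apply (opow_pos x a) in Hx. lra.
Qed.

Lemma opow_le (x y a : R) : 0 < a -> 0 <= x <= y -> opow x a <= opow y a.
Proof.
  intros Ha [[Hx | <-] Hxy].
  - rewrite !opow_pos_eq by lra. apply Rle_Rpower_l; lra.
  - rewrite opow_0. now apply opow_nonneg.
Qed.

(** One step of unwinding the equation: a bound on the quasi-derivative
    [r * opow x p] becomes a bound on [x] itself, with the weight [r]
    appearing to the power [- (1 / p)]. *)
Lemma quasi_derivative_bound (r x p k v : R) :
  0 < p -> 0 < r -> 0 < k -> 0 < v ->
  r * opow x p <= - k * v ->
  x <= - opow k (1 / p) * (opow r (- (1 / p)) * opow v (1 / p)).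
Proof.
  intros Hp Hr Hk Hv H.
  assert (Hkv : 0 < k * v) by now apply Rmult_lt_0_compat.
  assert (Hx : x < 0).
  { destruct (Rlt_or_le x 0) as [Hx | Hx]; [exact Hx |].
    apply (opow_nonneg x p) in Hx.
    assert (0 <= r * opow x p) by (apply Rmult_le_pos; lra). lra. }
  replace x with (- - x) in H by ring. rewrite opow_opp in H.
  assert (Hp0 : opow (- x) p = Rpower (- x) p) by (apply opow_pos_eq; lra).
  rewrite Hp0 in H.
  assert (Hle : k * v * / r <= Rpower (- x) p).
  { apply (Rmult_le_reg_r r); [exact Hr |]. field_simplify; lra. }
  assert (Hir : 0 < / r) by now apply Rinv_0_lt_compat.
  assert (Hip : 0 <= 1 / p) by (apply Rlt_le, Rdiv_lt_0_compat; lra).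
  assert (Hroot : Rpower (k * v * / r) (1 / p) <= - x).
  { replace (- x) with (Rpower (Rpower (- x) p) (1 / p)).
    - apply Rle_Rpower_l; [exact Hip |].
      split; [now apply Rmult_lt_0_compat | exact Hle].
    - rewrite Rpower_mult. replace (p * (1 / p)) with 1 by (field; lra).
      apply Rpower_1; lra. }
  rewrite <- !Rpower_mult_distr in Hroot by assumption.
  rewrite !opow_pos_eq by assumption.
  assert (Hinv : Rpower (/ r) (1 / p) = Rpower r (- (1 / p))).
  { unfold Rpower. rewrite ln_Rinv by exact Hr. f_equal. ring. }
  rewrite Hinv in Hroot. lra.
Qed.

Lemma continuous_opow_pos (x a : R) : 0 < x -> continuous (fun u => opow u a) x.
Proof.
  intros Hx.
  apply (continuous_ext_loc _ (fun u => Rpower u a)).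
  - generalize (open_gt 0 x Hx). apply filter_imp.
    intros u Hu. symmetry. now apply opow_pos_eq.
  - apply (ex_derive_continuous (fun u => Rpower u a) x).
    exists (a * Rpower x (a - 1)). apply is_derive_Reals, derivable_pt_lim_power, Hx.
Qed.

Lemma continuous_opow_0 (a : R) : 0 < a -> continuous (fun u => opow u a) 0.
Proof.
  intros Ha. apply filterlim_locally. intros eps.
  exists (mkposreal _ (Rpower_pos eps (/ a))). intros u Hu.
  change (Rabs (u - 0) < Rpower eps (/ a)) in Hu.
  change (Rabs (opow u a - opow 0 a) < eps).
  rewrite Rminus_0_r in Hu. rewrite opow_0, Rminus_0_r.
  destruct (Req_dec u 0) as [-> | Hu0].
  - rewrite opow_0, Rabs_R0. apply cond_pos.
  - assert (Habs : 0 < Rabs u) by now apply Rabs_pos_lt.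
    assert (Heq : Rabs (opow u a) = Rpower (Rabs u) a).
    { unfold opow. rewrite Rabs_mult, (Rabs_pos_eq (Rpower _ _))
        by (left; apply Rpower_pos).
      replace (Rabs (sign u)) with 1; [ring |].
      destruct (Rlt_or_le 0 u) as [Hp | Hp].
      - rewrite sign_eq_1 by exact Hp. now rewrite Rabs_R1.
      - rewrite sign_eq_m1 by lra. rewrite Rabs_left; lra. }
    rewrite Heq.
    replace (pos eps) with (Rpower (Rpower eps (/ a)) a).
    + now apply Rlt_Rpower_l.
    + rewrite Rpower_mult, Rinv_l by lra. apply Rpower_1, cond_pos.
Qed.

Lemma continuous_on_opow_pos (D : R -> Prop) (f : R -> R) (a : R) :
  continuous_on D f -> (forall t, D t -> 0 < f t) ->
  continuous_on D (fun t => opow (f t) a).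
Proof.
  intros Hf Hpos t Ht.
  apply (filterlim_comp _ _ _ f (fun u => opow u a) _ (locally (f t))).
  - now apply Hf.
  - now apply continuous_opow_pos, Hpos.
Qed.

(** The primitives of a nonnegative function may vanish on an initial interval,
    so continuity of a positive power at the base point [0] matters. *)
Lemma continuous_on_opow_nonneg (D : R -> Prop) (f : R -> R) (a : R) :
  0 < a -> continuous_on D f -> (forall t, D t -> 0 <= f t) ->
  continuous_on D (fun t => opow (f t) a).
Proof.
  intros Ha Hf Hpos t Ht.
  apply (filterlim_comp _ _ _ f (fun u => opow u a) _ (locally (f t))).
  - now apply Hf.
  - destruct (Hpos t Ht) as [H | H].
    + now apply continuous_opow_pos.
    + rewrite <- H. now apply continuous_opow_0.
Qed.

Lemma continuous_on_mult (D : R -> Prop) (f g : R -> R) :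
  continuous_on D f -> continuous_on D g -> continuous_on D (fun t => f t * g t).
Proof.
  intros Hf Hg t Ht.
  apply (filterlim_comp_2 (G := locally (f t)) (H := locally (g t)) f g Rmult).
  - now apply Hf.
  - now apply Hg.
  - exact (filterlim_mult (K := R_AbsRing) (f t) (g t)).
Qed.

(** * Calculus on a half-line *)

Lemma derivative_on_is_derive (T : R) (f g : R -> R) (t : R) :
  derivative_on T f g -> T < t -> is_derive f t (g t).
Proof.
  intros H Ht. apply is_derive_Reals. intros eps Heps.
  destruct (H t (Rlt_le _ _ Ht) eps Heps) as [d [Hd Hlim]].
  assert (Hm : 0 < Rmin d (t - T)) by (apply Rmin_pos; lra).
  exists (mkposreal _ Hm). intros h Hh0 Hh. simpl in Hh.
  pose proof (Rmin_l d (t - T)). pose proof (Rmin_r d (t - T)).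
  apply Rabs_def2 in Hh as Hh'.
  specialize (Hlim (t + h)). simpl in Hlim. unfold Rdist in Hlim.
  replace (t + h - t) with h in Hlim by ring.
  apply Hlim. repeat split; unfold half_line; lra.
Qed.

(** Freezing [f] to the left of [a] turns one-sided continuity at the end point
    into continuity, which is what the integration theorems ask for. *)
Lemma continuous_clamp (a : R) (f : R -> R) (x : R) :
  continuous_on (half_line a) f -> continuous (fun t => f (Rmax a t)) x.
Proof.
  intros Hf P HP.
  destruct (Hf (Rmax a x) (Rmax_l a x) P HP) as [eps Heps].
  exists eps. intros y Hy. apply Heps; [| apply Rmax_l].
  change (Rabs (y - x) < eps) in Hy.
  change (Rabs (Rmax a y - Rmax a x) < eps).
  apply Rabs_def2 in Hy. apply Rabs_def1; unfold Rmax;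
    destruct (Rle_dec a y), (Rle_dec a x); lra.
Qed.

Section Primitive.

Variables (a : R) (f : R -> R).
Hypothesis Hf : continuous_on (half_line a) f.

Let g (t : R) : R := f (Rmax a t).

Lemma is_derive_clamped_primitive (t : R) : is_derive (fun u => RInt g a u) t (g t).
Proof.
  apply (is_derive_RInt g _ a t).
  - apply filter_forall. intros u.
    apply (RInt_correct (V := R_CompleteNormedModule)).
    apply (ex_RInt_continuous (V := R_CompleteNormedModule)).
    intros v _. now apply continuous_clamp.
  - now apply continuous_clamp.
Qed.

Lemma clamped_primitive_eq (t : R) : a <= t -> RInt g a t = RInt f a t.
Proof.
  intros Ht. apply RInt_ext. intros x [Hx _]. rewrite Rmin_left in Hx by exact Ht.
  unfold g. now rewrite Rmax_right by lra.
Qed.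

Lemma is_derive_primitive (t : R) : a < t -> is_derive (fun u => RInt f a u) t (f t).
Proof.
  intros Ht.
  apply (is_derive_ext_loc (fun u => RInt g a u)).
  - generalize (open_gt a t Ht). apply filter_imp.
    intros u Hu. apply clamped_primitive_eq. lra.
  - replace (f t) with (g t) by (unfold g; now rewrite Rmax_right by lra).
    apply is_derive_clamped_primitive.
Qed.

Lemma continuous_on_primitive : continuous_on (half_line a) (fun u => RInt f a u).
Proof.
  intros t Ht. rewrite <- clamped_primitive_eq by exact Ht.
  apply (filterlim_within_ext _ (fun u => RInt g a u)).
  - intros u Hu. now apply clamped_primitive_eq.
  - eapply filterlim_filter_le_1; [apply filter_le_within |].
    apply (ex_derive_continuous (fun u => RInt g a u) t).
    eexists. apply is_derive_clamped_primitive.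
Qed.

Lemma primitive_nonneg (t : R) :
  (forall u, a <= u -> 0 <= f u) -> a <= t -> 0 <= RInt f a t.
Proof.
  intros Hpos Ht. rewrite <- clamped_primitive_eq by exact Ht.
  apply RInt_ge_0; [exact Ht | |].
  - apply (ex_RInt_continuous (V := R_CompleteNormedModule)).
    intros v _. now apply continuous_clamp.
  - intros u _. apply Hpos, Rmax_l.
Qed.

End Primitive.

(** * Functions near infinity *)

Notation eventually_holds P := (Rbar_locally p_infty P).

Lemma eventually_gt (a : R) : eventually_holds (fun t => a < t).
Proof. now exists a. Qed.

Lemma is_lim_p_infty_gt (f : R -> R) (M : R) :
  is_lim f p_infty p_infty -> eventually_holds (fun t => M < f t).
Proof. intros H. apply is_lim_spec in H. exact (H M). Qed.

Lemma nonincreasing_of_derive_nonpos (f f' : R -> R) :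
  eventually_holds (fun t => is_derive f t (f' t)) ->
  eventually_holds (fun t => f' t <= 0) ->
  exists M, forall s t, M < s -> s <= t -> f t <= f s.
Proof.
  intros [M1 H1] [M2 H2]. exists (Rmax M1 M2). intros s t Hs Hst.
  pose proof (Rmax_l M1 M2). pose proof (Rmax_r M1 M2).
  destruct (MVT_gen f s t f') as [c [Hc Heq]].
  - rewrite Rmin_left, Rmax_right by exact Hst.
    intros x Hx. apply H1. lra.
  - rewrite Rmin_left, Rmax_right by exact Hst.
    intros x Hx. apply continuity_pt_filterlim, (ex_derive_continuous f x).
    exists (f' x). apply H1. lra.
  - rewrite Rmin_left, Rmax_right in Hc by exact Hst.
    assert (Hc' : f' c <= 0) by (apply H2; lra).
    assert (0 <= - f' c * (t - s)) by (apply Rmult_le_pos; lra). lra.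
Qed.

Lemma eventually_derive_opp (f f' : R -> R) :
  eventually_holds (fun t => is_derive f t (f' t)) ->
  eventually_holds (fun t => is_derive (fun u => - f u) t (- f' t)).
Proof.
  apply filter_imp. intros t H. now apply (is_derive_opp f).
Qed.

Definition eventually_signed (f : R -> R) : Prop :=
  eventually_holds (fun t => f t <= 0) \/ eventually_holds (fun t => 0 <= f t).

(** A monotone function changes sign at most once. Applied to the
    quasi-derivatives from the highest order down, this fixes the
    sign of each of them near infinity. *)
Lemma eventually_signed_primitive (f f' : R -> R) :
  eventually_holds (fun t => is_derive f t (f' t)) ->
  eventually_signed f' -> eventually_signed f.
Proof.
  assert (Hdec : forall g g' : R -> R,
    eventually_holds (fun t => is_derive g t (g' t)) ->
    eventually_holds (fun t => g' t <= 0) -> eventually_signed g).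
  { intros g g' Hg Hg'.
    destruct (nonincreasing_of_derive_nonpos g g' Hg Hg') as [M HM].
    destruct (classic (exists s, M < s /\ g s <= 0)) as [[s [Hs Hgs]] | Hno].
    - left. exists s. intros t Ht. specialize (HM s t Hs (Rlt_le _ _ Ht)). lra.
    - right. exists M. intros t Ht. apply Rnot_lt_le. intros Hlt.
      apply Hno. exists t. lra. }
  intros Hf [Hneg | Hpos].
  - exact (Hdec f f' Hf Hneg).
  - destruct (Hdec _ _ (eventually_derive_opp f f' Hf)) as [H | H].
    + revert Hpos. apply filter_imp. intros t Ht. lra.
    + right. revert H. apply filter_imp. intros t Ht. lra.
    + left. revert H. apply filter_imp. intros t Ht. lra.
Qed.

Lemma monotone_positive_limit_or_bound (f f' : R -> R) :
  eventually_holds (fun t => is_derive f t (f' t)) ->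
  eventually_signed f' ->
  eventually_holds (fun t => 0 < f t) ->
  is_lim f p_infty 0 \/ exists c, 0 < c /\ eventually_holds (fun t => c <= f t).
Proof.
  intros Hf [Hneg | Hpos] [M0 H0].
  - destruct (nonincreasing_of_derive_nonpos f f' Hf Hneg) as [M HM].
    destruct (classic (exists c, 0 < c /\ forall t, Rmax M M0 < t -> c <= f t))
      as [[c [Hc Hb]] | Hno].
    + right. exists c. split; [exact Hc |]. now exists (Rmax M M0).
    + left. apply is_lim_spec. intros eps.
      apply NNPP. intros Hnot. apply Hno. exists eps. split; [apply cond_pos |].
      intros t Ht. apply Rnot_lt_le. intros Hlt. apply Hnot.
      pose proof (Rmax_l M M0). pose proof (Rmax_r M M0).
      exists t. intros u Hu. rewrite Rminus_0_r, Rabs_pos_eq.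
      * assert (f u <= f t) by (apply HM; lra). lra.
      * left. apply H0. lra.
  - right.
    destruct (nonincreasing_of_derive_nonpos _ _ (eventually_derive_opp f f' Hf))
      as [M HM].
    { revert Hpos. apply filter_imp. intros t Ht. lra. }
    pose proof (Rmax_l M M0). pose proof (Rmax_r M M0).
    exists (f (Rmax M M0 + 1)). split; [apply H0; lra |].
    exists (Rmax M M0 + 1). intros t Ht.
    assert (- f t <= - f (Rmax M M0 + 1)) by (apply HM; lra). lra.
Qed.

Lemma eventually_derive_combination (F f G g : R -> R) (k : R) :
  eventually_holds (fun t => is_derive F t (f t)) ->
  eventually_holds (fun t => is_derive G t (g t)) ->
  eventually_holds (fun t => is_derive (fun u => F u + k * G u) t (f t + k * g t)).
Proof.
  intros HF HG. generalize (filter_and _ _ HF HG). apply filter_imp.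
  intros t [HFt HGt].
  apply (is_derive_plus F (fun u => k * G u)); [exact HFt |].
  now apply is_derive_scal.
Qed.

(** Integrating [F' <= - k G'] leaves a constant of integration; as [G] tends
    to infinity, giving up half of the rate absorbs it. *)
Lemma integrate_rate (F f G g : R -> R) (k : R) :
  0 < k ->
  eventually_holds (fun t => is_derive F t (f t)) ->
  eventually_holds (fun t => is_derive G t (g t)) ->
  eventually_holds (fun t => f t <= - k * g t) ->
  is_lim G p_infty p_infty ->
  eventually_holds (fun t => F t <= - (k / 2) * G t).
Proof.
  intros Hk HF HG Hle Hlim.
  destruct (nonincreasing_of_derive_nonpos _ _
              (eventually_derive_combination F f G g k HF HG)) as [M HM].
  { revert Hle. apply filter_imp. intros t Ht. lra. }
  set (K := F (M + 1) + k * G (M + 1)).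
  generalize (filter_and _ _ (eventually_gt (M + 1))
                (is_lim_p_infty_gt G (K / (k / 2)) Hlim)).
  apply filter_imp. intros t [Ht HGt].
  assert (H1 : F t + k * G t <= K) by (apply HM; lra).
  apply (Rmult_lt_compat_l (k / 2)) in HGt; [| lra].
  replace (k / 2 * (K / (k / 2))) with K in HGt by (field; lra). lra.
Qed.

(** Were the nondecreasing [phi] not to tend to infinity, it would stay below
    some [N], and then [B' <= opow N p * A'] would bound [B] along with [A]. *)
Lemma weight_tends_to_infinity (A a B phi phi' : R -> R) (p : R) :
  0 < p ->
  eventually_holds (fun t => is_derive A t (a t)) ->
  eventually_holds (fun t => 0 <= a t) ->
  (exists K, eventually_holds (fun t => A t <= K)) ->
  eventually_holds (fun t => is_derive B t (a t * opow (phi t) p)) ->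
  is_lim B p_infty p_infty ->
  eventually_holds (fun t => is_derive phi t (phi' t)) ->
  eventually_holds (fun t => 0 <= phi' t) ->
  eventually_holds (fun t => 0 <= phi t) ->
  is_lim phi p_infty p_infty.
Proof.
  intros Hp HA Ha [K HK] HB HBlim Hphi Hphi' Hphi0.
  destruct (nonincreasing_of_derive_nonpos _ _ (eventually_derive_opp phi phi' Hphi))
    as [M HM].
  { revert Hphi'. apply filter_imp. intros t Ht. lra. }
  apply is_lim_spec. intros N. apply NNPP. intros Hnot.
  assert (Hbound : eventually_holds (fun t => phi t <= N)).
  { exists M. intros t Ht. apply Rnot_lt_le. intros Hlt. apply Hnot.
    exists t. intros u Hu. assert (- phi u <= - phi t) by (apply HM; lra). lra. }
  set (c := opow N p).
  destruct (nonincreasing_of_derive_nonpos _ _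
              (eventually_derive_combination B _ A a (- c) HB HA)) as [M' HM'].
  { generalize (filter_and _ _ Ha (filter_and _ _ Hphi0 Hbound)).
    apply filter_imp. intros t [Hat Hpt].
    assert (Hpow : opow (phi t) p <= c) by now apply opow_le.
    assert (0 <= a t * (c - opow (phi t) p)) by (apply Rmult_le_pos; lra).
    lra. }
  assert (Hc : 0 <= c).
  { destruct (filter_ex _ (filter_and _ _ Hphi0 Hbound)) as [t Ht].
    apply opow_nonneg. lra. }
  set (B0 := B (M' + 1) + - c * A (M' + 1)).
  destruct (filter_ex _ (filter_and _ _ (eventually_gt (M' + 1))
     (filter_and _ _ HK (is_lim_p_infty_gt B (B0 + c * K) HBlim))))
    as [t [Ht [HKt HBt]]].
  assert (H1 : B t + - c * A t <= B0) by (apply HM'; lra).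
  assert (0 <= c * (K - A t)) by (apply Rmult_le_pos; lra). lra.
Qed.

Lemma integral_finite_bounded (f : R -> R) (a : R) :
  integral_finite f a ->
  exists K, eventually_holds (fun t => RInt f a t <= K).
Proof.
  intros [l Hl]. exists (l + 1).
  destruct (Hl (fun x => x <= l + 1)) as [Q S HQ HS HQS].
  { exists (mkposreal 1 Rlt_0_1). intros x Hx.
    change (Rabs (x - l) < 1) in Hx. apply Rabs_def2 in Hx. lra. }
  revert HS. apply filter_imp. intros t Ht.
  destruct (HQS a t HQ Ht) as [v [Hv Hle]]. simpl in Hv.
  now rewrite (is_RInt_unique _ _ _ _ Hv).
Qed.

Lemma eventually_constant_sign (f f' : R -> R) (T : R) :
  (forall t, T < t -> is_derive f t (f' t)) ->
  (forall t, T < t -> f t <> 0) ->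
  (forall t, T < t -> 0 < f t) \/ (forall t, T < t -> f t < 0).
Proof.
  intros Hf Hnz.
  assert (Hcont : forall t, T < t -> continuity_pt f t).
  { intros t Ht. apply continuity_pt_filterlim, (ex_derive_continuous f t).
    exists (f' t). now apply Hf. }
  assert (Hivt : forall s t, T < s -> T < t -> f s < 0 -> 0 < f t -> False).
  { intros s t Hs Ht Hfs Hft.
    destruct (Rtotal_order s t) as [Hlt | [-> | Hlt]]; [| lra |].
    - destruct (IVT_interv f s t) as [x [Hx Hfx]]; auto.
      + intros x Hx. apply Hcont. lra.
      + apply (Hnz x); lra.
    - destruct (IVT_interv (fun u => - f u) t s) as [x [Hx Hfx]]; try lra.
      + intros x Hx. apply (continuity_pt_opp f), Hcont. lra.
      + apply (Hnz x); lra. }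
  destruct (classic (exists s, T < s /\ f s < 0)) as [[s [Hs Hfs]] | Hno].
  - right. intros t Ht. pose proof (Hnz t Ht).
    destruct (Rtotal_order (f t) 0) as [H0 | [H0 | H0]]; [exact H0 | lra |].
    exfalso. exact (Hivt s t Hs Ht Hfs H0).
  - left. intros t Ht. pose proof (Hnz t Ht).
    apply Rnot_le_lt. intros Hle. apply Hno. exists t. lra.
Qed.

(** * Eventually positive solutions *)

(** Stated with hypotheses near infinity only, in a form that serves both a
    positive solution [y] and the opposite of a negative one. *)
Lemma eventually_positive_solution_tends_to_0
  (alpha beta gamma : R) (r1 r2 q sigma Q P I y y1 z w : R -> R) :
  0 < alpha -> 0 < beta -> 0 < gamma ->
  eventually_holds (fun t => 0 < r1 t) ->
  eventually_holds (fun t => 0 < r2 t) ->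
  eventually_holds (fun t => 0 <= q t) ->
  eventually_holds (fun t => t <= sigma t) ->
  eventually_holds (fun t => is_derive Q t (q t)) ->
  eventually_holds (fun t =>
    is_derive P t (opow (r2 t) (- (1 / beta)) * opow (Q t) (1 / beta))) ->
  eventually_holds (fun t =>
    is_derive I t (opow (r1 t) (- (1 / alpha)) * opow (P t) (1 / alpha))) ->
  is_lim Q p_infty p_infty ->
  is_lim P p_infty p_infty ->
  is_lim I p_infty p_infty ->
  eventually_holds (fun t => 0 < y t) ->
  eventually_holds (fun t => is_derive y t (y1 t)) ->
  eventually_holds (fun t => is_derive (fun u => r1 u * opow (y1 u) alpha) t (z t)) ->
  eventually_holds (fun t => is_derive (fun u => r2 u * opow (z u) beta) t (w t)) ->
  eventually_holds (fun t => w t + q t * opow (y (sigma t)) gamma = 0) ->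
  is_lim y p_infty 0.
Proof.
  intros Halpha Hbeta Hgamma Hr1 Hr2 Hq Hsigma HQ HP HI HQlim HPlim HIlim
    Hy Hy1 Hz Hw Heq.
  assert (Hshift : forall S : R -> Prop,
    eventually_holds S -> eventually_holds (fun t => S (sigma t))).
  { intros S [M HS]. generalize (filter_and _ _ (eventually_gt M) Hsigma).
    apply filter_imp. intros t Ht. apply HS. lra. }
  assert (Hsw : eventually_signed w).
  { left. generalize (filter_and _ _ (Hshift _ Hy) (filter_and _ _ Hq Heq)).
    apply filter_imp. intros t [Hyt [Hqt Ht]].
    assert (0 <= q t * opow (y (sigma t)) gamma)
      by (apply Rmult_le_pos; [exact Hqt | left; now apply opow_pos]).
    lra. }
  (* The factor [r] and the odd power do not affect the sign. *)
  assert (Hunweight : forall (r x : R -> R) (p : R),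
    eventually_holds (fun t => 0 < r t) ->
    eventually_signed (fun t => r t * opow (x t) p) -> eventually_signed x).
  { intros r x p Hr [H | H]; [left | right];
      generalize (filter_and _ _ Hr H); apply filter_imp; intros t [Hrt Ht].
    - apply (opow_nonpos_inv _ p), (Rmult_le_reg_l (r t)); lra.
    - apply (opow_nonneg_inv _ p), (Rmult_le_reg_l (r t)); lra. }
  assert (Hsz : eventually_signed z).
  { apply (Hunweight r2 z beta Hr2).
    exact (eventually_signed_primitive _ w Hw Hsw). }
  assert (Hsy1 : eventually_signed y1).
  { apply (Hunweight r1 y1 alpha Hr1).
    exact (eventually_signed_primitive _ z Hz Hsz). }
  destruct (monotone_positive_limit_or_bound y y1 Hy1 Hsy1 Hy)
    as [Hlim | [c [Hc Hyc]]]; [exact Hlim | exfalso].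
  set (k0 := opow c gamma).
  assert (Hk0 : 0 < k0) by now apply opow_pos.
  assert (HL2 : eventually_holds (fun t =>
    r2 t * opow (z t) beta <= - (k0 / 2) * Q t)).
  { apply (integrate_rate _ w Q q k0 Hk0 Hw HQ); [| exact HQlim].
    generalize (filter_and _ _ (Hshift _ Hyc) (filter_and _ _ Hq Heq)).
    apply filter_imp. intros t [Hyt [Hqt Ht]].
    assert (Hle : k0 <= opow (y (sigma t)) gamma) by (apply opow_le; lra).
    assert (0 <= q t * (opow (y (sigma t)) gamma - k0))
      by (apply Rmult_le_pos; lra).
    lra. }
  (* Integrating the next two orders is the same argument. *)
  assert (Hdescend : forall (r x V F W : R -> R) (p k : R),
    0 < p -> 0 < k ->
    eventually_holds (fun t => 0 < r t) ->
    is_lim V p_infty p_infty -> is_lim W p_infty p_infty ->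
    eventually_holds (fun t =>
      is_derive W t (opow (r t) (- (1 / p)) * opow (V t) (1 / p))) ->
    eventually_holds (fun t => is_derive F t (x t)) ->
    eventually_holds (fun t => r t * opow (x t) p <= - k * V t) ->
    eventually_holds (fun t => F t <= - (opow k (1 / p) / 2) * W t)).
  { intros r x V F W p k Hp Hk Hr HV HW HdW HdF Hle.
    apply (integrate_rate F x W _ _ (opow_pos k (1 / p) Hk) HdF HdW); [| exact HW].
    generalize (filter_and _ _ (is_lim_p_infty_gt V 0 HV) (filter_and _ _ Hr Hle)).
    apply filter_imp. intros t [HVt [Hrt Ht]].
    now apply quasi_derivative_bound. }
  set (k1 := opow (k0 / 2) (1 / beta) / 2).
  assert (Hk1 : 0 < k1).
  { unfold k1. assert (0 < opow (k0 / 2) (1 / beta)) by (apply opow_pos; lra). lra. }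
  assert (HL1 : eventually_holds (fun t =>
    r1 t * opow (y1 t) alpha <= - k1 * P t)).
  { apply (Hdescend r2 z Q _ P beta (k0 / 2)); auto. lra. }
  assert (HL0 : eventually_holds (fun t =>
    y t <= - (opow k1 (1 / alpha) / 2) * I t)).
  { apply (Hdescend r1 y1 P _ I alpha k1); auto. }
  destruct (filter_ex _ (filter_and _ _ Hy
    (filter_and _ _ HL0 (is_lim_p_infty_gt I 0 HIlim)))) as [t [Hyt [Hle HIt]]].
  assert (Hk : 0 < opow k1 (1 / alpha)) by now apply opow_pos.
  assert (0 < opow k1 (1 / alpha) / 2 * I t) by (apply Rmult_lt_0_compat; lra).
  lra.
Qed.

Theorem theorem2p1
  (t0 alpha beta gamma : R) (r1 r2 q sigma dsigma : R -> R)
  (ht0 : 0 < t0)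
  (halpha : odd_quotient alpha)
  (hbeta : odd_quotient beta)
  (hgamma : odd_quotient gamma)
  (hr1_cont : continuous_on (half_line t0) r1)
  (hr1_pos : forall t, t0 <= t -> 0 < r1 t)
  (hr2_cont : continuous_on (half_line t0) r2)
  (hr2_pos : forall t, t0 <= t -> 0 < r2 t)
  (hr1_int : integral_finite (fun s => opow (r1 s) (- (1 / alpha))) t0)
  (hr2_int : integral_finite (fun s => opow (r2 s) (- (1 / beta))) t0)
  (hq_cont : continuous_on (half_line t0) q)
  (hq_nonneg : forall t, t0 <= t -> 0 <= q t)
  (hq_nonvanishing : ~ vanishes_eventually t0 q)
  (hsigma_pos : forall t, t0 <= t -> 0 < sigma t)
  (hsigma_deriv : derivative_on t0 sigma dsigma)
  (hdsigma_cont : continuous_on (half_line t0) dsigma)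
  (hsigma_ge : forall t, t0 <= t -> t <= sigma t)
  (hdsigma_nonneg : forall t, t0 <= t -> 0 <= dsigma t)
  (hsolutions : exists (Ty : R) (y : R -> R),
     is_proper_solution t0 alpha beta gamma r1 r2 q sigma Ty y)
  (hdiv : integral_infinite
     (fun v => opow (r1 v) (- (1 / alpha)) *
        opow (RInt (fun u => opow (r2 u) (- (1 / beta)) *
                      opow (RInt q t0 u) (1 / beta)) t0 v) (1 / alpha)) t0) :
  property_A t0 alpha beta gamma r1 r2 q sigma.
Proof.
  apply odd_quotient_pos in halpha, hbeta, hgamma.
  assert (Hia : 0 < 1 / alpha) by (apply Rdiv_lt_0_compat; lra).
  assert (Hib : 0 < 1 / beta) by (apply Rdiv_lt_0_compat; lra).
  assert (Hev : forall S : R -> Prop, (forall t, t0 <= t -> S t) -> eventually_holds S).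
  { intros S HS. exists t0. intros t Ht. apply HS. lra. }
  set (a1 := fun s => opow (r1 s) (- (1 / alpha))) in *.
  set (a2 := fun s => opow (r2 s) (- (1 / beta))) in *.
  set (Q := fun u => RInt q t0 u).
  set (p := fun u => a2 u * opow (Q u) (1 / beta)).
  set (P := fun v => RInt p t0 v).
  set (i := fun v => a1 v * opow (P v) (1 / alpha)).
  set (I := fun v => RInt i t0 v).
  assert (HIlim : is_lim I p_infty p_infty) by exact hdiv.
  assert (Ha1 : continuous_on (half_line t0) a1)
    by now apply continuous_on_opow_pos.
  assert (Ha2 : continuous_on (half_line t0) a2)
    by now apply continuous_on_opow_pos.
  assert (Ha1pos : forall t, t0 <= t -> 0 < a1 t)
    by (intros t Ht; now apply opow_pos, hr1_pos).
  assert (Ha2pos : forall t, t0 <= t -> 0 < a2 t)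
    by (intros t Ht; now apply opow_pos, hr2_pos).
  assert (HQpos : forall t, t0 <= t -> 0 <= Q t)
    by (intros t Ht; now apply primitive_nonneg).
  assert (Hp : continuous_on (half_line t0) p).
  { apply continuous_on_mult; [exact Ha2 |].
    apply continuous_on_opow_nonneg; [exact Hib | | exact HQpos].
    now apply continuous_on_primitive. }
  assert (Hppos : forall t, t0 <= t -> 0 <= p t).
  { intros t Ht. apply Rmult_le_pos; [left; now apply Ha2pos |].
    now apply opow_nonneg, HQpos. }
  assert (HPpos : forall t, t0 <= t -> 0 <= P t)
    by (intros t Ht; now apply primitive_nonneg).
  assert (Hi : continuous_on (half_line t0) i).
  { apply continuous_on_mult; [exact Ha1 |].
    apply continuous_on_opow_nonneg; [exact Hia | | exact HPpos].
    now apply continuous_on_primitive. }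
  assert (Hprim : forall f : R -> R, continuous_on (half_line t0) f ->
    eventually_holds (fun t => is_derive (fun u => RInt f t0 u) t (f t))).
  { intros f Hf. exists t0. intros t Ht. now apply is_derive_primitive. }
  assert (HPlim : is_lim P p_infty p_infty).
  { apply (weight_tends_to_infinity (fun t => RInt a1 t0 t) a1 I P p (1 / alpha));
      auto using integral_finite_bounded.
    - apply Hev. intros t Ht. left. now apply Ha1pos.
    - exact (Hprim i Hi).
    - exact (Hprim p Hp). }
  assert (HQlim : is_lim Q p_infty p_infty).
  { apply (weight_tends_to_infinity (fun t => RInt a2 t0 t) a2 P Q q (1 / beta));
      auto using integral_finite_bounded.
    - apply Hev. intros t Ht. left. now apply Ha2pos.
    - exact (Hprim p Hp).
    - exact (Hprim q hq_cont). }
  intros Ty y [[HTy [_ [y1 [z [w [_ [Hy1 [_ [Hz [_ [Hw Heq]]]]]]]]]]] _].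
  destruct (classic (oscillatory Ty y)) as [Hosc | Hosc]; [now left | right].
  assert (HT : exists T, Ty <= T /\ forall t, T < t -> y t <> 0).
  { apply NNPP. intros Hno. apply Hosc. intros T HT. apply NNPP. intros Hnz.
    apply Hno. exists T. split; [exact HT |]. intros t Ht H0.
    apply Hnz. exists t. lra. }
  destruct HT as [T [HT Hnz]].
  assert (HevT : forall S : R -> Prop, (forall t, T < t -> S t) -> eventually_holds S)
    by (intros S HS; now exists T).
  assert (Hdy : forall t, T < t -> is_derive y t (y1 t)).
  { intros t Ht. apply (derivative_on_is_derive Ty); [exact Hy1 | lra]. }
  assert (HdL1 : forall t, T < t ->
    is_derive (fun u => r1 u * opow (y1 u) alpha) t (z t)).
  { intros t Ht. apply (derivative_on_is_derive Ty); [exact Hz | lra]. }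
  assert (HdL2 : forall t, T < t ->
    is_derive (fun u => r2 u * opow (z u) beta) t (w t)).
  { intros t Ht. apply (derivative_on_is_derive Ty); [exact Hw | lra]. }
  assert (HeqT : forall t, T < t -> w t + q t * opow (y (sigma t)) gamma = 0).
  { intros t Ht. apply Heq. lra. }
  pose proof (Hprim q hq_cont) as HdQ.
  pose proof (Hprim p Hp) as HdP.
  pose proof (Hprim i Hi) as HdI.
  destruct (eventually_constant_sign y y1 T Hdy Hnz) as [Hpos | Hneg].
  - apply (eventually_positive_solution_tends_to_0 alpha beta gamma
             r1 r2 q sigma Q P I y y1 z w); auto.
  - (* All powers are odd, so [- y] solves the same equation. *)
    assert (Hopp : is_lim (fun t => - y t) p_infty 0).
    { apply (eventually_positive_solution_tends_to_0 alpha beta gamma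
               r1 r2 q sigma Q P I _
               (fun t => - y1 t) (fun t => - z t) (fun t => - w t)); auto.
      - apply HevT. intros t Ht. specialize (Hneg t Ht). lra.
      - apply HevT. intros t Ht. now apply (is_derive_opp y), Hdy.
      - apply HevT. intros t Ht.
        apply (is_derive_ext (fun u => - (r1 u * opow (y1 u) alpha))).
        + intros u. apply quasi_derivative_opp.
        + now apply (is_derive_opp (fun u => r1 u * opow (y1 u) alpha)), HdL1.
      - apply HevT. intros t Ht.
        apply (is_derive_ext (fun u => - (r2 u * opow (z u) beta))).
        + intros u. apply quasi_derivative_opp.
        + now apply (is_derive_opp (fun u => r2 u * opow (z u) beta)), HdL2.
      - apply HevT. intros t Ht. rewrite opow_opp.
        specialize (HeqT t Ht). lra. }
    apply is_lim_opp in Hopp. simpl in Hopp. rewrite Ropp_0 in Hopp.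
    revert Hopp. apply is_lim_ext. intros t. apply Ropp_involutive.
Qed.
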